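(* Let $\sigma\colon A^*\to B^*$ be an injective morphism between free monoids on finite alphabets, and let $\mathcal A$ be the flower automaton of $\sigma(A)$. The morphism $\sigma$ is recognizable for aperiodic points if and only if $\mathcal A$ is unambiguous for aperiodic points.
   Context: $S$ denotes the shift, $S(x)_n=x_{n+1}$. A point $y\in B^{\mathbb Z}$ is aperiodic if $S^n(y)\ne y$ for all $n\ge 1$. For $x\in A^{\mathbb Z}$, $\sigma(x)=\cdots\sigma(x_{-1})\cdot\sigma(x_0)\sigma(x_1)\cdots$. A centered $\sigma$-representation of $y\in B^{\mathbb Z}$ is a pair $(x,k)$ with $x\in A^{\mathbb Z}$, $y=S^k(\sigma(x))$, $0\le k<|\sigma(x_0)|$. The morphism $\sigma$ is recognizable for aperiodic points if every aperiodic $y\in B^{\mathbb Z}$ has at most one centered $\sigma$-representation. For a finite set $U\subset B^+$ of nonempty words, the flower automaton of $U$ is the labeled graph with set of states $\{(u,v)\in B^+\times B^+\mid uv\in U\}\cup\{\omega\}$, where $\omega$ is a new element, and with the following edges labeled by $a\in B$: $(u,av)\xrightarrow{a}(ua,v)$ for $uav\in U$ with $u,v$ nonempty; $\omega\xrightarrow{a}(a,v)$ for $av\in U$ with $v$ nonempty; $(u,a)\xrightarrow{a}\omega$ for $ua\in U$ with $u$ nonempty; $\omega\xrightarrow{a}\omega$ for $a\in U$. An automaton is unambiguous for aperiodic points if for every aperiodic two-sided infinite word $x$ there is at most one two-sided infinite path of the automaton labeled by $x$. *)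

(* Defs.v *)
From mathcomp Require Import all_boot all_order all_algebra finmap.
Set Implicit Arguments.
Unset Strict Implicit.
Unset Printing Implicit Defensive.
Import GRing.Theory Num.Theory.
Local Open Scope ring_scope.

(* Two-sided infinite words over T are functions [int -> T], compared with the
   pointwise equality [=1]. *)

Definition shift (T : Type) (x : int -> T) : int -> T := fun n => x (n + 1).

Definition aperiodic (T : Type) (y : int -> T) : Prop :=
  forall n : nat, (0 < n)%N -> ~ (iter n (@shift T) y =1 y).

Definition word_morphism (A B : Type) (sigma : seq A -> seq B) : Prop :=
  sigma [::] = [::] /\ {morph sigma : u v / u ++ v}.

Section BiinfiniteImage.

Variables (A B : Type) (sigma : seq A -> seq B).

(* The position in sigma(x) at which the block sigma(x_n) starts, the block
   sigma(x_0) starting at 0; [Negz i] is -(i+1). *)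
Definition block_start (x : int -> A) (n : int) : int :=
  match n with
  | Posz m => (\sum_(i < m) size (sigma [:: x i%:Z]))%N%:Z
  | Negz m => - (\sum_(i < m.+1) size (sigma [:: x (Negz i)]))%N%:Z
  end.

(* z = sigma(x): every position i of z lies in some block sigma(x_n), and z_i
   is the corresponding letter of that block ([onth w j = Some b] entails
   j < |w|). When sigma is erasing and the concatenation is not infinite on
   both sides, no z satisfies this. *)
Definition biinfinite_image (x : int -> A) (z : int -> B) : Prop :=
  forall i : int, exists (n : int) (j : nat),
    i = block_start x n + j%:Z /\ onth (sigma [:: x n]) j = Some (z i).

Definition centered_representation (y : int -> B) (x : int -> A) (k : nat) :
    Prop :=
  (exists2 z, biinfinite_image x z & y =1 iter k (@shift B) z)
  /\ (k < size (sigma [:: x 0]))%N.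

Definition recognizable_for_aperiodic : Prop :=
  forall y : int -> B, aperiodic y ->
  forall (x x' : int -> A) (k k' : nat),
    centered_representation y x k -> centered_representation y x' k' ->
    x =1 x' /\ k = k'.

End BiinfiniteImage.

Record automaton (B : Type) := Automaton {
  state : Type;
  edge : state -> B -> state -> Prop
}.

(* Since an edge is determined by its label and its two ends, a path labeled by
   y is determined by the states it visits. *)
Definition labeled_path (B : Type) (M : automaton B) (y : int -> B)
    (q : int -> state M) : Prop :=
  forall n : int, edge (q n) (y n) (q (n + 1)).

Definition unambiguous_for_aperiodic (B : Type) (M : automaton B) : Prop :=
  forall y : int -> B, aperiodic y ->
  forall q q' : int -> state M,
    labeled_path y q -> labeled_path y q' -> q =1 q'.

Section FlowerAutomaton.

Variables (B : choiceType) (U : {fset seq B}).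

Definition is_inner_state (p : seq B * seq B) : bool :=
  [&& p.1 != [::], p.2 != [::] & p.1 ++ p.2 \in U].

(* [None] is the state omega. *)
Definition flower_state : Type := option {p : seq B * seq B | is_inner_state p}.

Inductive flower_step :
  option (seq B * seq B) -> B -> option (seq B * seq B) -> Prop :=
| FlowerInner (u v : seq B) (a : B) of
    u != [::] & v != [::] & u ++ a :: v \in U :
    flower_step (Some (u, a :: v)) a (Some (rcons u a, v))
| FlowerLeave (v : seq B) (a : B) of v != [::] & a :: v \in U :
    flower_step None a (Some ([:: a], v))
| FlowerEnter (u : seq B) (a : B) of u != [::] & rcons u a \in U :
    flower_step (Some (u, [:: a])) a None
| FlowerLoop (a : B) of [:: a] \in U :
    flower_step None a None.

Definition flower_automaton : automaton B :=
  {| state := flower_state;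
     edge := fun q a q' => flower_step (omap val q) a (omap val q') |}.

End FlowerAutomaton.

(* Main.v *)
Require Import Defs.
From mathcomp Require Import all_boot all_order all_algebra finmap.
From mathcomp Require Import zify.
Local Open Scope fset_scope.

Set Implicit Arguments.
Unset Strict Implicit.
Unset Printing Implicit Defensive.
Import GRing.Theory Num.Theory.

(** Both sides of the equivalence describe the same data attached to a
    two-sided infinite word y: a cutting of y into blocks that are code words
    sigma(a).  The proof makes this precise through an intermediate object, a
    reading of y, which gives for every position n the letter a whose block
    covers n together with the offset of n in that block, subject to a rule
    that only relates the positions n and n + 1.

    - Centered representations of y are the readings of y seen globally.  From
      (x, k) one reads off the letter and the offset at each position
      ([representation_reading]).  Conversely a reading yields x by jumping
      from one block start to the next, on both sides of the block that
      covers position 0, while k is the offset at 0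
      ([reading_representation]).  These passages determine each other
      ([reading_inj], [reading_of_inj]).

    - Paths labeled by y are the readings of y seen locally.  The offset j in
      the word w is the state that cuts w into its first j letters and the
      rest, omega being the cut with an empty side, and every edge of the
      automaton moves such a cut by one letter ([flower_stepP]).  The state
      omega alone forgets which word is being read; but a whole edge, with its
      label, determines both the word and the offset ([split_step_inj]), and
      the word determines the letter as sigma is injective.  Hence paths and
      readings correspond bijectively ([path_reading], [reading_pathP],
      [reading_path_inj]).

    So each y has as many centered representations as labeled paths, and the
    two uniqueness properties agree on any given class of words y, here the
    aperiodic ones. *)

(** * Two-sided recursion over the integers *)

Section IntegerInduction.
Local Open Scope ring_scope.

Lemma int_bi_ind (P : int -> Prop) :
  P 0 -> (forall n, P n -> P (n + 1)) -> (forall n, P (n + 1) -> P n) ->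
  forall n, P n.
Proof.
move=> P0 up down; elim=> [//|n IHn|n IHn].
  by rewrite -addn1 PoszD; apply: up.
by apply: down; have -> : - n.+1%:Z + 1 = - n%:Z by lia.
Qed.

(** The iterates of f extend to all integers as soon as g gives every point of P
    a preimage under f in P.  This enumerates the block starts of a reading:
    the jump back to the preceding block start is
    inverted by the jump to the next one only at block starts. *)
Lemma bi_orbit (T : Type) (P : T -> Prop) (f g : T -> T) (x0 : T) :
    P x0 -> (forall x, P x -> P (f x)) -> (forall x, P x -> P (g x)) ->
    (forall x, P x -> f (g x) = x) ->
  exists p : int -> T,
    [/\ p 0 = x0, forall m, P (p m) & forall m, p (m + 1) = f (p m)].
Proof.
move=> P0 Pf Pg fgK.
have Pfi i : P (iter i f x0) by elim: i => //= i; apply: Pf.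
have Pgi i : P (iter i g x0) by elim: i => //= i; apply: Pg.
exists (fun m => match m with Posz i => iter i f x0 | Negz i => iter i.+1 g x0 end).
split=> [//|[i|i]|]; [exact: Pfi | exact: (Pgi i.+1) |].
case=> [i|[|i]]; first by rewrite -PoszD addn1.
  by rewrite fgK.
have -> : Negz i.+1 + 1 = Negz i by lia.
by rewrite [in RHS]iterS fgK //; apply: (Pgi i.+1).
Qed.

Lemma iter_shift (T : Type) (z : int -> T) (k : nat) (n : int) :
  iter k (@shift T) z n = z (n + k%:Z).
Proof.
elim: k n => [|k IHk] n /=; first by rewrite addr0.
by rewrite {1}/shift IHk -addrA -PoszD add1n.
Qed.

End IntegerInduction.

(** * Readings and centered representations *)

Lemma onth_size (T : Type) (s : seq T) (j : nat) (b : T) :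
  onth s j = Some b -> j < size s.
Proof. by move=> E; rewrite -onthTE E. Qed.

Section Readings.
Local Open Scope ring_scope.

Variables (A : Type) (B : eqType) (sigma : seq A -> seq B).
Local Notation code a := (sigma [:: a]).
Local Notation block_start := (block_start sigma).
Hypothesis nonerasing : forall a, (0 < size (code a))%N.

Lemma block_startS (x : int -> A) (m : int) :
  block_start x (m + 1) = block_start x m + (size (code (x m)))%:Z.
Proof.
case: m => [i|[|i]].
- by rewrite -PoszD addn1 /= big_ord_recr.
- by rewrite /= big_ord0 big_ord_recr big_ord0 /= add0n addNr.
have -> : Negz i.+1 + 1 = Negz i by lia.
by rewrite /= [in RHS]big_ord_recr /= PoszD opprD addrNK.
Qed.

Lemma block_start0 (x : int -> A) : block_start x 0 = 0.
Proof. by rewrite /= big_ord0. Qed.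

(** The one-step recurrence, unlike the defining sums, treats both signs of m
    uniformly; the cutting points found in a reading are compared with block
    starts through it. *)
Lemma block_start_unique (x : int -> A) (p : int -> int) :
    (forall m, p (m + 1) = p m + (size (code (x m)))%:Z) ->
  forall m, p m = p 0 + block_start x m.
Proof.
move=> pS; apply: int_bi_ind => [|m IHm|m].
- by rewrite block_start0 addr0.
- by rewrite pS block_startS IHm addrA.
by rewrite pS block_startS addrA => /addIr.
Qed.

Lemma block_start_le (x : int -> A) (m m' : int) :
  m <= m' -> block_start x m <= block_start x m'.
Proof.
move=> le_mm'; have -> : m' = m + `|m' - m|%N%:Z by lia.
elim: `|_|%N => [|d IHd]; first by rewrite addr0.
have -> : m + d.+1%:Z = m + d%:Z + 1 by lia.
by rewrite block_startS; lia.
Qed.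

(** Blocks are nonempty, so moving one position to the left or to the right
    either stays in the same block or enters the adjacent one. *)
Lemma address_exists (x : int -> A) (i : int) :
  exists m (j : nat), i = block_start x m + j%:Z /\ (j < size (code (x m)))%N.
Proof.
elim/int_bi_ind: i => [|i [m [j [-> ltj]]]|i [m [[|j] [Ei ltj]]]].
- by exists 0, 0%N; rewrite block_start0 addr0; split.
- have [ltj1|] := ltnP j.+1 (size (code (x m))).
    by exists m, j.+1; split=> //; lia.
  by exists (m + 1), 0%N; split=> //; rewrite block_startS; lia.
- exists (m - 1), (size (code (x (m - 1)))).-1.
  have := block_startS x (m - 1); have := nonerasing (x (m - 1)).
  by rewrite subrK; split; lia.
by exists m, j; split; lia.
Qed.

Lemma address_unique (x : int -> A) (m m' : int) (j j' : nat) :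
    block_start x m + j%:Z = block_start x m' + j'%:Z ->
    (j < size (code (x m)))%N -> (j' < size (code (x m')))%N ->
  m = m' /\ j = j'.
Proof.
move=> E ltj ltj'.
have := @block_start_le x (m + 1) m'; have := @block_start_le x (m' + 1) m.
rewrite !block_startS => le1 le2.
have Em : m = m' by lia.
by subst m'; split; lia.
Qed.

(** After the last letter of a block any letter may follow, hence only the
    offset is constrained in that case. *)
Definition next_place (s s' : A * nat) : Prop :=
  if (s.2.+1 < size (code s.1))%N then s' = (s.1, s.2.+1) else s'.2 = 0%N.

Definition reading (y : int -> B) (r : int -> A * nat) : Prop :=
  forall n, onth (code (r n).1) (r n).2 = Some (y n) /\
            next_place (r n) (r (n + 1)).

(** The position with address (m, j) in sigma(x) is [block_start x m + j - k] in
    y, since y is sigma(x) shifted by k. *)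
Definition reading_of (x : int -> A) (k : nat) (r : int -> A * nat) : Prop :=
  forall m j, (j < size (code (x m)))%N ->
    r (block_start x m + j%:Z - k%:Z) = (x m, j).

Lemma representation_reading (y : int -> B) (x : int -> A) (k : nat) :
    centered_representation sigma y x k ->
  exists2 r, reading y r & reading_of x k r.
Proof.
case=> -[z xz yz] _.
pose addr (n : int) (mj : int * nat) :=
  (n + k%:Z == block_start x mj.1 + mj.2%:Z) &&
  (onth (code (x mj.1)) mj.2 == Some (y n)).
have addrP n : exists mj, addr n mj.
  have [m [j [E Ey]]] := xz (n + k%:Z).
  by exists (m, j); rewrite /addr /= yz iter_shift Ey E !eqxx.
have [a aP] : exists a : int -> int * nat, forall n : int,
    n + k%:Z = block_start x (a n).1 + (a n).2%:Z /\
    onth (code (x (a n).1)) (a n).2 = Some (y n).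
  exists (fun n => xchoose (addrP n)) => n.
  by have /andP[/eqP-> /eqP->] := xchooseP (addrP n).
have a_eq (n : int) (m : int) (j : nat) : n + k%:Z = block_start x m + j%:Z ->
    (j < size (code (x m)))%N -> a n = (m, j).
  move=> + ltj; have [En Ey] := aP n; have lta := onth_size Ey.
  rewrite En => E; have [] := address_unique E lta ltj.
  by case: (a n) => ? ? /= -> ->.
exists (fun n => (x (a n).1, (a n).2)) => [n|m j ltj]; last first.
  by rewrite (a_eq _ m j) //; lia.
have [En Ey] := aP n; split=> //=; rewrite /next_place /=.
case: ltnP => [lt_a|ge_a].
  by rewrite (a_eq _ (a n).1 (a n).2.+1) //; lia.
rewrite (a_eq _ ((a n).1 + 1) 0%N) //; rewrite block_startS.
by have := onth_size Ey; lia.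
Qed.

(** Every position of y has an address in sigma(x), where both readings are
    prescribed. *)
Lemma reading_inj (x x' : int -> A) (k : nat) (r r' : int -> A * nat) :
    x =1 x' -> reading_of x k r -> reading_of x' k r' -> r =1 r'.
Proof.
move=> xx' rx rx' n; have [m [j [E ltj]]] := address_exists x (n + k%:Z).
have -> : n = block_start x m + j%:Z - k%:Z by lia.
have Eb : block_start x' m = block_start x m.
  rewrite (@block_start_unique x' (block_start x)) ?block_start0 ?add0r // => i.
  by rewrite block_startS xx'.
by rewrite rx // -Eb rx' -?xx'.
Qed.

(** The offset at position 0 is k.  Equal block starts force equal letters, since
    the reading shows the letter there; the block starts then agree from one
    block to the next, and also backwards, by looking at the last letter of the
    preceding block. *)
Lemma reading_of_inj (x x' : int -> A) (k k' : nat) (r : int -> A * nat) :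
    (k < size (code (x 0)))%N -> (k' < size (code (x' 0)))%N ->
    reading_of x k r -> reading_of x' k' r ->
  x =1 x' /\ k = k'.
Proof.
move=> ltk ltk' rx rx'.
have Ek : k = k'.
  have := rx 0 k ltk; have := rx' 0 k' ltk'.
  by rewrite !block_start0 !add0r !subrr => -> [].
subst k'; split=> //.
have same m : block_start x m = block_start x' m -> x m = x' m.
  move=> E; have := rx m 0%N (nonerasing _); have := rx' m 0%N (nonerasing _).
  by rewrite E => -> [].
move=> m; apply: (same); elim/int_bi_ind: m => [|m E|m E].
- by rewrite !block_start0.
- by rewrite !block_startS E (same m E).
(* The blocks m of x and of x' end at the same place, hence share the position
   of their last letter, where r shows both x m and x' m. *)
have lt1 := nonerasing (x m); have lt1' := nonerasing (x' m).
have := rx m (size (code (x m))).-1; have := rx' m (size (code (x' m))).-1.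
rewrite !block_startS in E.
have -> : block_start x m + (size (code (x m))).-1%:Z =
  block_start x' m + (size (code (x' m))).-1%:Z by lia.
rewrite !ltn_predL => /(_ lt1') -> /(_ lt1) [Exx _].
by move: E; rewrite Exx => /addIr.
Qed.

(** Within a block a reading can be traced back: an offset is either 0 or one more
    than the preceding one. *)
Lemma reading_back (y : int -> B) (r : int -> A * nat) (n : int) (i : nat) :
  reading y r -> (i <= (r n).2)%N -> r (n - i%:Z) = ((r n).1, (r n).2 - i)%N.
Proof.
move=> ry; elim: i => [|i IHi] lei.
  by rewrite subr0 subn0; case: (r n).
have {IHi} IHi := IHi (ltnW lei).
have [_] := ry (n - i.+1%:Z).
have -> : n - i.+1%:Z + 1 = n - i%:Z by lia.
rewrite /next_place IHi; case: ifP => _ /=; last by lia.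
by case: (r (n - _)) => c j /= [-> E]; congr pair; lia.
Qed.

Lemma reading_forth (y : int -> B) (r : int -> A * nat) (n : int) (i : nat) :
    reading y r -> (r n).2 = 0%N -> (i < size (code (r n).1))%N ->
  r (n + i%:Z) = ((r n).1, i).
Proof.
move=> ry rn0; elim: i => [|i IHi] lti.
  by rewrite addr0 -rn0; case: (r n).
have := (ry (n + i%:Z)).2.
by rewrite /next_place (IHi (ltnW lti)) /= lti -addrA -PoszD addn1.
Qed.

(** The cutting points p m of the reading are found by jumping from block start to
    block start; x m is the letter read at p m, and p 0 is the start of the block
    that covers position 0. *)
Lemma reading_representation (y : int -> B) (r : int -> A * nat) :
    reading y r ->
  exists x k, centered_representation sigma y x k /\ reading_of x k r.
Proof.
move=> ry; pose k := (r 0).2.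
have lt_r n : ((r n).2 < size (code (r n).1))%N by apply: onth_size (ry n).1.
pose f (n : int) := n + (size (code (r n).1))%:Z.
(* From a block start n, the preceding block is the one that covers n - 1. *)
pose g (n : int) := n - (size (code (r (n - 1)).1))%:Z.
have rf n : (r n).2 = 0%N -> (r (f n)).2 = 0%N.
  move=> rn0; have sz := nonerasing (r n).1.
  have rl : r (n + (size (code (r n).1)).-1%:Z) =
            ((r n).1, (size (code (r n).1)).-1).
    by apply: reading_forth; rewrite ?prednK.
  have := (ry (n + (size (code (r n).1)).-1%:Z)).2.
  rewrite /next_place rl /= prednK // ltnn /f.
  by have -> : n + (size (code (r n).1)).-1%:Z + 1 =
               n + (size (code (r n).1))%:Z by lia.
have rg n : (r n).2 = 0%N -> r (g n) = ((r (n - 1)).1, 0%N).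
  move=> rn0; have := (ry (n - 1)).2; rewrite subrK /next_place.
  case: ifP => [_ E|/negbT]; first by rewrite E in rn0.
  rewrite -leqNgt => le_sz _; have ltn := lt_r (n - 1).
  rewrite -[0%N](subnn (r (n - 1)).2) -(@reading_back y r (n - 1) (r (n - 1)).2) //.
  by congr r; rewrite /g; lia.
have [||||p [p0 Pp pS]] := @bi_orbit int (fun n => (r n).2 = 0%N) f g (- k%:Z).
- by rewrite -[- _]add0r (reading_back ry) //= subnn.
- exact: rf.
- by move=> n /rg->.
- by move=> n /rg rgn; rewrite /f rgn /g subrK.
pose x m := (r (p m)).1.
have bsE m : block_start x m - k%:Z = p m.
  by rewrite (@block_start_unique x p) // p0 addrC.
have rx : reading_of x k r.
  by move=> m j ltj; rewrite addrAC bsE (reading_forth ry).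
exists x, k; split=> //; split.
  exists (fun i => y (i - k%:Z)); last by move=> n; rewrite iter_shift addrK.
  move=> i; have [m [j [-> ltj]]] := address_exists x i.
  by exists m, j; split=> //; have := (ry (block_start x m + j%:Z - k%:Z)).1; rewrite rx.
by rewrite /x p0 -[- _]add0r (reading_back ry) //= lt_r.
Qed.

End Readings.

(** * Edges of the flower automaton *)

Section FlowerStates.

Variables (B : choiceType) (V : {fset seq B}).
Implicit Types (u v w : seq B) (a : B).

(** The state reached after reading j letters of w.  For w in V,
    [insub] gives omega (None) exactly when one side of the cut is empty, so that
    both ends of w are treated like the inner positions. *)
Definition split_state w (j : nat) : flower_state V :=
  insub (take j w, drop j w).

Lemma val_split_state w j : w \in V ->
  omap val (split_state w j) =
  if 0 < j < size w then Some (take j w, drop j w) else None.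
Proof.
move=> Vw; rewrite /split_state; set p := (_, _).
have -> : (0 < j < size w) = is_inner_state V p.
  rewrite /is_inner_state /= cat_take_drop Vw andbT -!size_eq0 size_drop size_take.
  by rewrite -!lt0n subn_gt0; case: (j < size w); rewrite ?andbF ?andbT.
by case: insubP => [u -> /= ->|/negbTE->].
Qed.

Lemma val_state_inj : injective (omap val : flower_state V -> _).
Proof. by move=> [u|] [v|] //= [] /val_inj ->. Qed.

Lemma onth_cut w j a : onth w j = Some a ->
  exists u v, w = u ++ a :: v /\ j = size u.
Proof.
move=> wj; have ltj := onth_size wj.
exists (take j w), (drop j.+1 w); rewrite size_takel ?(ltnW ltj) //; split=> //.
by rewrite -[LHS](cat_take_drop j) (drop_nth a) // (onth_nth _ _ _ _ wj).
Qed.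

Lemma val_split_cut u a v : u ++ a :: v \in V ->
    omap val (split_state (u ++ a :: v) (size u)) =
      (if u == [::] then None else Some (u, a :: v))
 /\ omap val (split_state (u ++ a :: v) (size u).+1) =
      (if v == [::] then None else Some (rcons u a, v)).
Proof.
move=> Vw; rewrite !val_split_state // size_cat /=.
rewrite !addnS !ltnS leq_addr andbT take_size_cat // drop_size_cat //.
rewrite -cat_rcons take_size_cat ?drop_size_cat ?size_rcons //.
rewrite -[X in X < _ + _]addn0 ltn_add2l.
by case: (u) => [|b u1]; case: (v).
Qed.

(** The four kinds of edges are one: reading the letter of w at offset j.  They
    only differ by whether the letters before and after it are missing. *)
Lemma flower_stepP (q q' : flower_state V) a :
  flower_step V (omap val q) a (omap val q') <->
  exists w j, [/\ w \in V, onth w j = Some a,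
                  q = split_state w j & q' = split_state w j.+1].
Proof.
split=> [st|[w [j [Vw /onth_cut[u [v [Ew ->]]] -> ->]]]].
  have [u [v [Vw Eq Eq']]] : exists u v, [/\ u ++ a :: v \in V,
      omap val q = (if u == [::] then None else Some (u, a :: v)) &
      omap val q' = (if v == [::] then None else Some (rcons u a, v))].
    case: st => [u v b u0 v0 Vw|v b v0 Vw|u b u0 Vw|b Vw].
    - by exists u, v; rewrite (negbTE u0) (negbTE v0).
    - by exists [::], v; rewrite (negbTE v0).
    - by exists u, [::]; rewrite (negbTE u0) cats1.
    - by exists [::], [::].
  exists (u ++ a :: v), (size u); have [Ej Ej1] := val_split_cut Vw.
  split=> //; first by rewrite onth_cat ltnn subnn.
    by apply: val_state_inj; rewrite Eq Ej.
  by apply: val_state_inj; rewrite Eq' Ej1.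
rewrite {}Ew in Vw *; have [-> ->] := val_split_cut Vw.
case: u v Vw => [|b u] [|c v] Vw /=.
- exact: FlowerLoop.
- exact: FlowerLeave.
- by apply: FlowerEnter; rewrite // -cats1.
- exact: FlowerInner.
Qed.

(** The first state gives the prefix before the letter, with omega standing for the
    empty prefix; the second state likewise gives the suffix after it. *)
Lemma split_step_inj w w' j j' a : w \in V -> w' \in V ->
    onth w j = Some a -> onth w' j' = Some a ->
    split_state w j = split_state w' j' ->
    split_state w j.+1 = split_state w' j'.+1 ->
  w = w' /\ j = j'.
Proof.
move=> Vw Vw' /onth_cut[u [v [Ew ->]]] /onth_cut[u' [v' [Ew' ->]]].
rewrite {}Ew {}Ew' in Vw Vw' * => /(congr1 (omap val)) + /(congr1 (omap val)).
have [-> ->] := val_split_cut Vw; have [-> ->] := val_split_cut Vw'.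
move=> Eu Ev; have -> : u = u'.
  by case: eqP Eu => [->|_]; case: eqP => [->|_] // [].
suff -> : v = v' by [].
by case: eqP Ev => [->|_]; case: eqP => [->|_] // [].
Qed.

Lemma split_state_next w w' j j' : w \in V -> w' \in V -> j' < size w' ->
  (split_state w' j' = split_state w j.+1 <->
   if j.+1 < size w then w' = w /\ j' = j.+1 else j' = 0).
Proof.
move=> Vw Vw' ltj'; split=> [/(congr1 (omap val))|].
  rewrite !val_split_state // ltj' andbT /=; case: ifP => [_|ltj].
    case: ifP => // ltj [Et Ed].
    have Ew : w' = w by rewrite -(cat_take_drop j' w') Et Ed cat_take_drop.
    split=> //; have := congr1 size Et; rewrite !size_takel ?(ltnW ltj) //.
    exact: ltnW.
  by case: ifP => // _ _; move: ltj; rewrite lt0n => /negbFE/eqP.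
case: ifP => [_ [-> ->] //|ltj ->]; apply: val_state_inj.
by rewrite !val_split_state // ltj.
Qed.

End FlowerStates.

(** * Readings and paths *)

Section ReadingPaths.
Local Open Scope ring_scope.

Variables (A B : finType) (sigma : seq A -> seq B).
Local Notation code a := (sigma [:: a]).
Hypothesis code_inj : injective (fun a : A => code a).
Local Notation U := [fset code a | a : A].

Definition reading_path (r : int -> A * nat) (n : int) : flower_state U :=
  split_state U (code (r n).1) (r n).2.

Lemma code_in (a : A) : code a \in U.
Proof. by apply/imfsetP; exists a. Qed.

(** The rule for readings at two consecutive positions is exactly the gluing
    condition for two consecutive edges. *)
Lemma next_placeP (s s' : A * nat) : (s'.2 < size (code s'.1))%N ->
  next_place sigma s s' <->
  split_state U (code s'.1) s'.2 = split_state U (code s.1) s.2.+1.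
Proof.
move=> lts'; rewrite split_state_next ?code_in // /next_place.
case: ifP => // _; split=> [-> //|[/code_inj <- <-]].
by case: s' {lts'}.
Qed.

Lemma reading_pathP (y : int -> B) (r : int -> A * nat) :
  reading sigma y r -> labeled_path (M := flower_automaton U) y (reading_path r).
Proof.
move=> ry n; apply/flower_stepP; have [ryn step] := ry n.
exists (code (r n).1), (r n).2; split=> //; first exact: code_in.
by apply/next_placeP => //; apply: onth_size (ry _).1.
Qed.

Lemma path_reading (y : int -> B) (q : int -> state (flower_automaton U)) :
    labeled_path y q ->
  exists2 r, reading sigma y r & q =1 reading_path r.
Proof.
move=> qy.
pose at_place (n : int) (s : A * nat) :=
  [&& onth (code s.1) s.2 == Some (y n),
      (q n : flower_state U) == split_state U (code s.1) s.2 &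
      (q (n + 1) : flower_state U) == split_state U (code s.1) s.2.+1].
have placeP n : exists s, at_place n s.
  have /flower_stepP[_ [j [/imfsetP[a _ ->] /= wj E E']]] := qy n.
  by exists (a, j); apply/and3P; split; apply/eqP.
have [r rP] : exists r : int -> A * nat, forall n, at_place n (r n).
  by exists (fun n => xchoose (placeP n)) => n; apply: xchooseP.
have {rP} rP n : [/\ onth (code (r n).1) (r n).2 = Some (y n),
    q n = reading_path r n &
    q (n + 1) = split_state U (code (r n).1) (r n).2.+1].
  by have /and3P[/eqP ? /eqP ? /eqP ?] := rP n.
exists r => n; have [ryn qn qn1] := rP n; last by [].
split=> //; have [ryn1 qn1' _] := rP (n + 1).
by apply/next_placeP; [exact: onth_size ryn1 | rewrite -qn1 qn1'].
Qed.

Lemma reading_path_inj (y : int -> B) (r r' : int -> A * nat) :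
    reading sigma y r -> reading sigma y r' ->
    reading_path r =1 reading_path r' -> r =1 r'.
Proof.
move=> ry ry' rr' n; have [ryn step] := ry n; have [ryn' step'] := ry' n.
have split1 : split_state U (code (r n).1) (r n).2.+1 =
              split_state U (code (r' n).1) (r' n).2.+1.
  move/next_placeP: step => <-; last exact: onth_size (ry _).1.
  move/next_placeP: step' => <-; last exact: onth_size (ry' _).1.
  exact: rr'.
have [/code_inj E1 E2] :=
  split_step_inj (code_in _) (code_in _) ryn ryn' (rr' n) split1.
by case: (r n) (r' n) E1 E2 => ? ? [? ?] /= -> ->.
Qed.

End ReadingPaths.

(** * The equivalence *)

Theorem theorem6p5 (A B : finType) (sigma : seq A -> seq B)
    (sigma_morph : word_morphism sigma) (sigma_inj : injective sigma) :
  recognizable_for_aperiodic sigma <->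
  unambiguous_for_aperiodic (flower_automaton [fset sigma [:: a] | a : A]).
Proof.
have code_inj : injective (fun a : A => sigma [:: a]).
  by move=> a b /sigma_inj [].
have nonerasing a : 0 < size (sigma [:: a]).
  case: posnP => // /size0nil; rewrite -sigma_morph.1.
  by move/sigma_inj.
split=> [recog y y_aper q q' qy qy' n | unamb y y_aper x x' k k' xy xy'].
  have [r ry qr] := path_reading code_inj qy.
  have [r' ry' qr'] := path_reading code_inj qy'.
  have [x [k [xy rx]]] := reading_representation nonerasing ry.
  have [x' [k' [xy' rx']]] := reading_representation nonerasing ry'.
  have [xx' kk'] := recog y y_aper x x' k k' xy xy'; subst k'.
  by rewrite qr qr' /reading_path (reading_inj nonerasing xx' rx rx').
have [r ry rx] := representation_reading nonerasing xy.
have [r' ry' rx'] := representation_reading nonerasing xy'.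
have rr' : r =1 r'.
  apply: (reading_path_inj code_inj ry ry').
  by apply: (unamb y y_aper); apply: reading_pathP.
apply: (reading_of_inj nonerasing xy.2 xy'.2 rx).
by move=> m j ltj; rewrite rr'; apply: rx'.
Qed.
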